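(* Let $R$ be a maximal subring of a ring $T$ and $I$ be a nonzero ideal of $T$ such that $R\cap I=0$. Then either $Soc({}_RR)=Soc({}_RT)\subseteq (R:T)_r$ or the following hold: (1) $Soc({}_RT)=Soc({}_RR)\oplus Soc({}_RI)$. (2) $Soc({}_RI)=I$, i.e., ${}_RI$ is a semisimple left $R$-module. (3) All simple $R$-submodules of ${}_RI$ are isomorphic as left $R$-modules. In fact, ${}_RI\cong \bigoplus_{\alpha\in \Gamma}S$ as left $R$-modules, for a simple left $R$-submodule $S$ of $I$ and a set $\Gamma$. (4) $(R:T)_r$ is a left primitive ideal of $R$. In particular, $J(R)\subseteq (R:T)_r$. (5) $J(R)=J(T)\cap R$ and $Nil^*(R)=Nil^*(T)\cap R$. (6) If in addition $I^2=0$, then $I=RaR$ for each $0\neq a\in I$.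
   Context: All rings are associative and unital (not necessarily commutative), and subrings contain the identity of the big ring; ''ideal'' means two-sided ideal. A maximal subring $R$ of $T$ is a proper subring with no subring strictly between $R$ and $T$. $Soc({}_RM)$ is the socle of a left $R$-module $M$. $(R:T)_r=\{x\in T: xT\subseteq R\}$, which is an ideal of $R$. $J$ is the Jacobson radical and $Nil^*$ the upper nilradical (the largest nil ideal). $RaR$ is the set of finite sums $\sum r_ias_i$ with $r_i,s_i\in R$. *)

(* Defs.v *)
From HB Require Import structures.
From mathcomp Require Import all_boot all_order all_algebra.
From mathcomp Require Import boolp classical_sets functions cardinality.

Set Implicit Arguments.
Unset Strict Implicit.
Unset Printing Implicit Defensive.

Import GRing.Theory.

Local Open Scope classical_set_scope.
Local Open Scope ring_scope.

(* Rings are [pzRingType]s: unital, associative, possibly noncommutative and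
   possibly zero.  A module is a left module [M : lmodType A]; its submodules
   are represented by their underlying sets [N : set M]. *)

Section Modules.
Variables (A : pzRingType) (M : lmodType A).
Implicit Types N S : set M.

Definition submodule N : Prop := submod_closed [in N].

Definition simple_submodule S : Prop :=
  [/\ submodule S, S <> [set 0] &
      forall K : set M, submodule K -> K `<=` S -> K = [set 0] \/ K = S].

(* The socle of the module N, as a subset of the ambient module M: the sum of
   all simple submodules of N, i.e. all finite sums of elements taken from
   simple submodules of N. *)
Definition soc N : set M :=
  [set x | exists (n : nat) (u : 'I_n -> M),
     (forall i, exists S, [/\ simple_submodule S, S `<=` N & S (u i)]) /\
     x = \sum_(i < n) u i].

Definition direct_sum_of (X Y Z : set M) : Prop :=
  X = [set y + z | y in Y & z in Z] /\ Y `&` Z = [set 0].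

(* The external direct sum of copies of S indexed by G, as a submodule of the
   module of all functions G -> M. *)
Definition direct_power (G : Type) S : set (G -> M) :=
  [set f | (forall g, S (f g)) /\ finite_set [set g | f g != 0]].

End Modules.

Arguments direct_power {A M} G S.

Definition submodule_iso (A : pzRingType) (M N : lmodType A)
    (X : set M) (Y : set N) : Prop :=
  exists f : M -> N,
    [/\ set_bij X Y f, {in X &, {morph f : x y / x + y}} &
        forall a : A, {in X, {morph f : x / a *: x}}].

Section Rings.
Variable A : pzRingType.
Implicit Types I J : set A.

Definition left_ideal I : Prop := submodule (I : set A^o).

Definition ideal I : Prop :=
  left_ideal I /\ forall x a : A, I x -> I (x * a).

(* The product of ideals: finite sums of products. *)
Definition ideal_mul I J : set A :=
  [set x | exists (n : nat) (u v : 'I_n -> A),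
     (forall i, I (u i) /\ J (v i)) /\ x = \sum_(i < n) u i * v i].

Definition maximal_left_ideal I : Prop :=
  [/\ left_ideal I, I <> setT &
      forall J : set A, left_ideal J -> I `<=` J -> J = I \/ J = setT].

Definition jacobson : set A := \bigcap_(I in maximal_left_ideal) I.

Definition nil_set I : Prop := forall x : A, I x -> exists n : nat, x ^+ n = 0.

(* The union of all nil ideals; [upper_nilradical_ideal],
   [upper_nilradical_nil] and [upper_nilradical_max] below show that it is the
   largest nil ideal. *)
Definition upper_nilradical : set A :=
  \bigcup_(I in [set I | ideal I /\ nil_set I]) I.

Definition annihilator (M : lmodType A) : set A :=
  [set a | forall x : M, a *: x = 0].

Definition left_primitive I : Prop :=
  exists2 M : lmodType A, simple_submodule [set: M] & I = annihilator M.

Lemma idealP I : ideal I <->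
  [/\ I 0, (forall x y, I x -> I y -> I (x + y)), (forall a x, I x -> I (a * x))
    & (forall x a, I x -> I (x * a))].
Proof.
split.
  move=> [[I0 Ilin] Ir]; have {}I0 : I 0 by exact: set_mem I0.
  have {}Ilin a x y : I x -> I y -> I (a * x + y).
    by move=> /mem_set Ix /mem_set Iy; exact: set_mem (Ilin a x y Ix Iy).
  split=> // [x y Ix Iy|a x Ix]; first by rewrite -[x]mul1r; exact: Ilin.
  by rewrite -[a * x]addr0; exact: Ilin.
move=> [I0 ID Il Ir]; split=> //; split; first by rewrite inE.
by move=> a x y; rewrite !inE => Ix Iy; apply: ID => //; exact: Il.
Qed.

Lemma ideal_add I J : ideal I -> ideal J -> ideal [set x + y | x in I & y in J].
Proof.
move=> /idealP[I0 ID Il Ir] /idealP[J0 JD Jl Jr]; apply/idealP; split.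
- by exists 0 => //; exists 0 => //; rewrite addr0.
- move=> _ _ [x Ix [y Jy <-]] [x' Ix' [y' Jy' <-]].
  exists (x + x'); first exact: ID.
  by exists (y + y'); [exact: JD | rewrite addrACA].
- move=> a _ [x Ix [y Jy <-]]; exists (a * x); first exact: Il.
  by exists (a * y); [exact: Jl | rewrite mulrDr].
- move=> _ a [x Ix [y Jy <-]]; exists (x * a); first exact: Ir.
  by exists (y * a); [exact: Jr | rewrite mulrDl].
Qed.

Lemma nil_set_add I J : ideal J -> nil_set I -> nil_set J ->
  nil_set [set x + y | x in I & y in J].
Proof.
move=> /idealP[J0 JD Jl Jr] nI nJ _ [x Ix [y Jy <-]].
have [n xn0] := nI _ Ix.
have [z Jz xyE] : exists2 z, J z & (x + y) ^+ n = x ^+ n + z.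
  elim: n {xn0} => [|n [z Jz IHn]]; first by exists 0; rewrite ?addr0.
  exists (x * z + y * (x + y) ^+ n).
    by apply: JD; [exact: Jl | exact: Jr].
  by rewrite exprS mulrDl {1}IHn mulrDr -exprS addrA.
have [m zm0] := nJ _ Jz.
by exists (n * m)%N; rewrite exprM xyE xn0 add0r.
Qed.

Lemma upper_nilradical_max I : ideal I -> nil_set I -> I `<=` upper_nilradical.
Proof. by move=> idI nI x Ix; exists I. Qed.

Lemma upper_nilradical_nil : nil_set upper_nilradical.
Proof. by move=> x [I [_ nI] /nI]. Qed.

Lemma upper_nilradical_ideal : ideal upper_nilradical.
Proof.
apply/idealP; split.
- exists [set 0] => //; split; last by move=> _ ->; exists 1%N; rewrite expr1.
  by apply/idealP; split=> // [_ _ -> ->|a _ ->|_ a ->];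
    rewrite ?addr0 ?mulr0 ?mul0r.
- move=> x y [I [idI nI] Ix] [J [idJ nJ] Jy].
  exists [set x + y | x in I & y in J]; last by exists x => //; exists y.
  by split; [exact: ideal_add | exact: nil_set_add].
- move=> a x [I [idI nI] Ix]; exists I => //.
  by have /idealP[_ _ Il _] := idI; exact: Il.
- move=> x a [I [idI nI] Ix]; exists I => //.
  by have /idealP[_ _ _ Ir] := idI; exact: Ir.
Qed.

End Rings.

Arguments jacobson A : clear implicits.
Arguments upper_nilradical A : clear implicits.

Definition maximal_subring (T : pzRingType) (R : subringClosed T) : Prop :=
  (exists x : T, x \notin R) /\
  forall S : {pred T}, subring_closed S -> {subset R <= S} ->
    S =i R \/ S =i predT.

(* T as a left R-module. *)
Definition res_scalars (T : pzRingType) (R : subringClosed T) : Type := T.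

Section Subring.
Variables (T : pzRingType) (R : subringClosed T).

(* The subring R as a ring in its own right; [val] is the inclusion into T. *)
Definition subring_type : Type := {x : T | x \in R}.
HB.instance Definition _ := SubChoice.on subring_type.
HB.instance Definition _ :=
  GRing.SubChoice_isSubPzRing.Build _ _ subring_type (subringClosedP _).

HB.instance Definition _ := GRing.Zmodule.copy (res_scalars R) T.

Let scale (r : subring_type) (x : res_scalars R) : res_scalars R :=
  val r * (x : T).

Let scaleA a b x : scale a (scale b x) = scale (a * b) x.
Proof. by rewrite /scale rmorphM /= mulrA. Qed.

Let scale1 : left_id 1 scale.
Proof. by move=> x; rewrite /scale rmorph1 mul1r. Qed.

Let scaleDr : right_distributive scale +%R.
Proof. by move=> a x y; exact: mulrDr. Qed.

Let scaleDl x : {morph scale^~ x : a b / a + b}.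
Proof. by move=> a b; rewrite /scale rmorphD /=; exact: mulrDl. Qed.

HB.instance Definition _ := GRing.Zmodule_isLmodule.Build
  subring_type (res_scalars R) scaleA scale1 scaleDr scaleDl.

(* The conductor (R : T)_r. *)
Definition rconductor : set T := [set x | forall t : T, x * t \in R].

(* RaR *)
Definition bimodule_span (a : T) : set T :=
  [set x | exists (n : nat) (r s : 'I_n -> subring_type),
     x = \sum_(i < n) val (r i) * a * val (s i)].

End Subring.

(* Main.v *)
Require Import Defs.
From HB Require Import structures.
From mathcomp Require Import all_boot all_order all_algebra.
From mathcomp Require Import boolp classical_sets functions cardinality.
From mathcomp Require Import fsbigop.

Set Implicit Arguments.
Unset Strict Implicit.
Unset Printing Implicit Defensive.

Import GRing.Theory.

Local Open Scope classical_set_scope.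
Local Open Scope ring_scope.

(* Since R is maximal, T = R (+) I, and a nonzero left R-submodule of I that is
   also stable under right multiplication by T is the whole of I.  If I contains
   no simple left R-submodule, then every simple R-submodule of T lies in R, and
   the socle of T, being right T-stable, lies in (R : T)_r.  Otherwise let S be a
   simple submodule of I: the trace of S in I, i.e. the sum of the images of all
   R-linear maps S -> I, is right T-stable, hence equals I, and a maximal
   independent family of such maps identifies I with a direct power of S.
   Consequently (R : T)_r = ann_R(I) = ann_R(S) is primitive.  As J(R) and Nil*(R)
   annihilate I, for x in J(R) we get xT = xR, contained in J(R), which puts x in
   J(T); and the elements t of T whose projection to R lies in Nil*(R) and with
   tI = 0 form a nil ideal of T. *)

(** * Finite sums of elements of a set *)

Section FiniteSums.
Variable V : nmodType.
Implicit Types B : set V.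

(** Same encoding as in [soc], so that [soc], [trace] and [span] are all instances and share one
    induction principle. *)
Definition fsums B : set V :=
  [set x | exists (n : nat) (u : 'I_n -> V),
     (forall i, B (u i)) /\ x = \sum_(i < n) u i].

Lemma fsums0 B : fsums B 0.
Proof. by exists 0%N, (fun=> 0); split=> [[]//|]; rewrite big_ord0. Qed.

Lemma fsums1 B x : B x -> fsums B x.
Proof. by move=> Bx; exists 1%N, (fun=> x); split=> //; rewrite big_ord1. Qed.

Lemma fsumsD B x y : fsums B x -> fsums B y -> fsums B (x + y).
Proof.
move=> [n [u [Bu ->]]] [m [v [Bv ->]]].
exists (n + m)%N, (fun i => match fintype.split i with inl j => u j | inr k => v k end).
split=> [i|]; first by case: fintype.split.
rewrite big_split_ord; congr (_ + _); apply: eq_bigr => i _.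
  by rewrite (unsplitK (inl i : 'I_n + 'I_m)).
by rewrite (unsplitK (inr i : 'I_n + 'I_m)).
Qed.

Lemma fsums_ind B (P : set V) : P 0 -> (forall x y, P x -> P y -> P (x + y)) ->
  B `<=` P -> fsums B `<=` P.
Proof.
by move=> P0 PD BP x [n [u [Bu ->]]]; apply: big_ind => // i _; exact: BP.
Qed.

End FiniteSums.

(** * Submodules, simple submodules and socles *)

Section Submodules.
Variables (A : pzRingType) (M : lmodType A).
Implicit Types N S : set M.

Lemma submoduleP N : submodule N <->
  [/\ N 0, (forall x y, N x -> N y -> N (x + y)) & (forall a x, N x -> N (a *: x))].
Proof.
split=> [[N0 Nlin]|[N0 ND NZ]]; last first.
  split; first by rewrite inE.
  by move=> a x y; rewrite !inE => Nx Ny; apply: ND => //; exact: NZ.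
have {}N0 : N 0 by exact: set_mem N0.
have {}Nlin a x y : N x -> N y -> N (a *: x + y).
  by move=> /mem_set Nx /mem_set Ny; exact: set_mem (Nlin a x y Nx Ny).
split=> // [x y Nx Ny|a x Nx]; first by rewrite -[x]scale1r; exact: Nlin.
by rewrite -[_ *: _]addr0; exact: Nlin.
Qed.

Lemma submoduleN N x : submodule N -> N x -> N (- x).
Proof. by move=> /submoduleP[_ _ NZ] /(NZ (-1)); rewrite scaleN1r. Qed.

Lemma submodule_sum N (J : Type) (r : seq J) (P : pred J) (F : J -> M) :
  submodule N -> (forall i, P i -> N (F i)) -> N (\sum_(i <- r | P i) F i).
Proof. by move=> /submoduleP[N0 ND _] NF; apply: big_ind. Qed.

(** The intersection of [K] and [S] is a nonzero submodule of [S], hence all of [S]. This is the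
    form in which simplicity is used throughout. *)
Lemma simple_submodule_full S K x : simple_submodule S -> submodule K ->
  K x -> S x -> x <> 0 -> S `<=` K.
Proof.
move=> [subS _ minS] subK Kx Sx x0.
have /submoduleP[S0 SD SZ] := subS; have /submoduleP[K0 KD KZ] := subK.
have subKS : submodule (K `&` S).
  by apply/submoduleP; split=> [//|y z [? ?] [? ?]|a y [? ?]];
    split; [exact: KD | exact: SD | exact: KZ | exact: SZ].
case: (minS _ subKS) => [y []//|KS0|<-]; last by move=> y [].
by have : (K `&` S) x by []; rewrite KS0 => /x0.
Qed.

Lemma nonzero_submodule S : submodule S -> S <> [set 0] ->
  exists2 x, S x & x <> 0.
Proof.
move=> /submoduleP[S0 _ _] Sn0; apply: contrapT => noS; apply: Sn0.
apply/seteqP; split=> [x Sx|_ ->//]; apply: contrapT => x0.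
by apply: noS; exists x.
Qed.

Lemma submodule_fsums (B : set M) :
  (forall a x, B x -> B (a *: x)) -> submodule (fsums B).
Proof.
move=> BZ; apply/submoduleP; split; [exact: fsums0 | exact: fsumsD |].
move=> a; apply: (@fsums_ind _ _ [set x | fsums B (a *: x)]) => /=.
- by rewrite scaler0; exact: fsums0.
- by move=> x y Bx By; rewrite scalerDr; exact: fsumsD.
- by move=> x /BZ-/(_ a)/fsums1.
Qed.

Lemma socE N :
  soc N = fsums [set x | exists S, [/\ simple_submodule S, S `<=` N & S x]].
Proof. by []. Qed.

Lemma soc_submodule N : submodule (soc N).
Proof.
rewrite socE; apply: submodule_fsums => a x [S [simS SN Sx]]; exists S; split=> //.
by have [/submoduleP[_ _ SZ] _ _] := simS; exact: SZ.
Qed.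

Lemma simple_soc N S : simple_submodule S -> S `<=` N -> S `<=` soc N.
Proof. by move=> simS SN x Sx; rewrite socE; apply: fsums1; exists S. Qed.

Lemma soc_ind N (P : set M) : P 0 -> (forall x y, P x -> P y -> P (x + y)) ->
  (forall S, simple_submodule S -> S `<=` N -> S `<=` P) -> soc N `<=` P.
Proof.
by move=> P0 PD PS; rewrite socE; apply: fsums_ind => // x [S [simS SN Sx]]; exact: PS Sx.
Qed.

Lemma soc_sub N : submodule N -> soc N `<=` N.
Proof. by move=> /submoduleP[N0 ND _]; exact: soc_ind. Qed.

Lemma socS N N' : N `<=` N' -> soc N `<=` soc N'.
Proof.
move=> NN'; have /submoduleP[s0 sD _] := soc_submodule N'.
apply: soc_ind => // S simS SN; apply: simple_soc => //.
exact: subset_trans NN'.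
Qed.

End Submodules.

(** * Linear maps defined on a submodule *)

Section Homs.
Variables (A : pzRingType) (M M' : lmodType A).
Implicit Types (S : set M) (N K : set M') (phi : M -> M').

(** A homomorphism from [S] to [N] is a total function on [M], constrained only on [S]; no type for
    [S] has to be built. *)
Definition hom_on S (N : set M') phi : Prop :=
  [/\ (forall x, S x -> N (phi x)),
      (forall x y, S x -> S y -> phi (x + y) = phi x + phi y) &
      (forall a x, S x -> phi (a *: x) = a *: phi x)].

Lemma hom_on0 S N phi : submodule S -> hom_on S N phi -> phi 0 = 0.
Proof.
move=> /submoduleP[S0 _ _] [_ _ homZ].
by rewrite -[X in phi X](scale0r (0 : M)) homZ // scale0r.
Qed.

Lemma hom_onN S N phi x : submodule S -> hom_on S N phi -> S x ->
  phi (- x) = - phi x.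
Proof. by move=> subS [_ _ homZ] Sx; rewrite -scaleN1r homZ // scaleN1r. Qed.

Lemma hom_on_preim S N phi K : submodule S -> hom_on S N phi -> submodule K ->
  submodule (S `&` phi @^-1` K).
Proof.
move=> subS hphi /submoduleP[K0 KD KZ].
have phi0 := hom_on0 subS hphi; have [_ hD hZ] := hphi.
have /submoduleP[S0 SD SZ] := subS.
apply/submoduleP; split=> [|x y [Sx Kx] [Sy Ky]|a x [Sx Kx]].
- by split=> //=; rewrite phi0.
- by split=> /=; [exact: SD | rewrite hD //; exact: KD].
- by split=> /=; [exact: SZ | rewrite hZ //; exact: KZ].
Qed.

Lemma submodule0 : submodule [set 0 : M'].
Proof.
by apply/submoduleP; split=> // [_ _ -> ->|a _ ->]; rewrite ?addr0 ?scaler0.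
Qed.

Lemma hom_on_image S N phi : submodule S -> hom_on S N phi ->
  submodule (phi @` S).
Proof.
move=> subS hphi; have phi0 := hom_on0 subS hphi; have [_ hD hZ] := hphi.
have /submoduleP[S0 SD SZ] := subS.
apply/submoduleP; split=> [|_ _ [x Sx <-] [y Sy <-]|a _ [x Sx <-]].
- by exists 0.
- by exists (x + y); [exact: SD | exact: hD].
- by exists (a *: x); [exact: SZ | exact: hZ].
Qed.

(** Schur: the kernel is a submodule of [S], and a nonzero element in it would force it to contain
    [x]. *)
Lemma simple_hom_inj S N phi x : simple_submodule S -> hom_on S N phi ->
  S x -> phi x <> 0 -> set_inj S phi.
Proof.
move=> simS hphi Sx phix0; have [subS _ _] := simS; have [_ hD hZ] := hphi.
have /submoduleP[S0 SD SZ] := subS.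
have inj0 y : S y -> phi y = 0 -> y = 0.
  move=> Sy phiy0; apply: contrapT => y0; apply: phix0.
  have subK := hom_on_preim subS hphi submodule0.
  by have [] := simple_submodule_full simS subK (conj Sy phiy0) Sy y0 Sx.
move=> y z /set_mem Sy /set_mem Sz eyz; have SNz := submoduleN subS Sz.
apply/subr0_eq/inj0; first exact: SD.
by rewrite hD // (hom_onN subS hphi) // eyz subrr.
Qed.

(** A nonzero submodule of the image pulls back to a nonzero submodule of [S], which is then all of
    [S]. *)
Lemma simple_hom_image S N phi x : simple_submodule S -> hom_on S N phi ->
  S x -> phi x <> 0 -> simple_submodule (phi @` S).
Proof.
move=> simS hphi Sx phix0; have [subS _ _] := simS.
split=> [||K subK KS]; first exact: hom_on_image hphi.
  by move=> im0; apply: phix0; have : (phi @` S) (phi x) by []; rewrite im0.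
have [K0|] := pselect (K = [set 0]); [by left | move=> Kn0; right].
have [w Kw phiw0] := nonzero_submodule subK Kn0.
have [y Sy eyw] := KS _ Kw; move: Kw phiw0; rewrite -eyw => Ky phiy0.
have subL := hom_on_preim subS hphi subK.
have y0 : y <> 0 by move=> y0; apply: phiy0; rewrite y0 (hom_on0 subS hphi).
have SL := simple_submodule_full simS subL (conj Sy Ky) Sy y0.
by apply/seteqP; split=> // _ [z Sz <-]; have [] := SL _ Sz.
Qed.

Lemma simple_hom_soc S N phi : simple_submodule S -> hom_on S N phi ->
  forall x, S x -> soc N (phi x).
Proof.
move=> simS hphi x Sx; have [phi0|phi0] := pselect (phi x = 0).
  by rewrite phi0; have /submoduleP[] := soc_submodule N.
apply: (simple_soc (simple_hom_image simS hphi Sx phi0)); last by exists x.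
by have [hN _ _] := hphi; move=> _ [y /hN Ny <-].
Qed.

Lemma submodule_isoP (X : set M) (Y : set M') :
  (exists2 f, hom_on X Y f & set_inj X f /\ Y `<=` f @` X) ->
  submodule_iso X Y.
Proof.
move=> [f [fXY fD fZ] [finj fsurj]]; exists f; split.
- by split.
- by move=> x y /set_mem ? /set_mem ?; exact: fD.
- by move=> a x /set_mem ?; exact: fZ.
Qed.

Lemma simple_hom_iso S (S' : set M') phi x : simple_submodule S ->
  simple_submodule S' -> hom_on S S' phi -> S x -> phi x <> 0 ->
  submodule_iso S S'.
Proof.
move=> simS simS' hphi Sx phix0; apply: submodule_isoP; exists phi => //.
split; first exact: simple_hom_inj hphi Sx phix0.
have [subS _ _] := simS; have [phiS' _ _] := hphi.
apply: (simple_submodule_full simS' (hom_on_image subS hphi) _ _ phix0).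
  by exists x.
exact: phiS'.
Qed.

End Homs.

Lemma hom_on_comp (A : pzRingType) (M1 M2 M3 : lmodType A) (X : set M1)
    (Y : set M2) (Z : set M3) f g :
  hom_on X Y f -> hom_on Y Z g -> hom_on X Z (g \o f).
Proof.
move=> [fY fD fZ] [gZ gD gZZ]; split=> [x Xx|x y Xx Xy|a x Xx] /=.
- exact/gZ/fY.
- by rewrite fD // gD //; exact: fY.
- by rewrite fZ // gZZ //; exact: fY.
Qed.

Lemma submodule_iso_sym (A : pzRingType) (M M' : lmodType A) (X : set M)
    (Y : set M') : submodule X ->
  submodule_iso X Y -> submodule_iso Y X.
Proof.
move=> /submoduleP[X0 XD XZ] [f [[fXY finj fsurj] fD fZ]].
have {}fD x y : X x -> X y -> f (x + y) = f x + f y.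
  by move=> Xx Xy; apply: fD; exact: mem_set.
have {}fZ a x : X x -> f (a *: x) = a *: f x by move=> Xx; apply: fZ; exact: mem_set.
have {}finj x y : X x -> X y -> f x = f y -> x = y.
  by move=> Xx Xy; apply: finj; exact: mem_set.
(* The inverse must be a total function; outside [Y] it takes the irrelevant value 0. *)
have /choice[g gP] : forall y, exists x, Y y -> X x /\ f x = y.
  move=> y; have [/fsurj[x Xx <-]|nYy] := pselect (Y y); first by exists x.
  by exists 0.
have gX y : Y y -> X (g y) by move=> /gP[].
have fgK y : Y y -> f (g y) = y by move=> /gP[].
have gfK x : X x -> g (f x) = x.
  by move=> Xx; have Yfx := fXY _ Xx; apply: finj; [exact: gX | | exact: fgK].
apply: submodule_isoP; exists g; split=> //.
- move=> y z Yy Yz; rewrite -[in LHS](fgK _ Yy) -[in LHS](fgK _ Yz) -fD ?gfK //;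
    by [exact: gX | apply: XD; exact: gX].
- by move=> a y Yy; rewrite -[in LHS](fgK _ Yy) -fZ ?gfK //;
    [apply: XZ; exact: gX | exact: gX].
- by move=> y z /set_mem Yy /set_mem Yz gyz; rewrite -(fgK y) // gyz fgK.
- by move=> x Xx; exists (f x); [exact: fXY | exact: gfK].
Qed.

(** * Traces of simple modules *)

Section Decomposition.
Variables (A : pzRingType) (M M' : lmodType A) (S : set M) (N : set M').
Hypotheses (simS : simple_submodule S) (subN : submodule N).

Definition trace : set M' :=
  fsums [set y | exists2 phi, hom_on S N phi & (phi @` S) y].

(** Injectivity of the evaluation map from the direct sum of copies of [S] indexed by [G], phrased
    through finite relations without forming that sum. *)
Definition independent (G : set (M -> M')) : Prop :=
  forall (s : seq (M -> M')) (f : (M -> M') -> M), uniq s ->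
    (forall phi, phi \in s -> G phi) -> (forall phi, S (f phi)) ->
    \sum_(phi <- s) phi (f phi) = 0 -> forall phi, phi \in s -> f phi = 0.

Definition span (G : set (M -> M')) : set M' :=
  fsums [set y | exists2 phi, G phi & (phi @` S) y].

Let subS : submodule S. Proof. by case: simS. Qed.

(** Zorn applies because independence has finite character: a relation involves finitely many maps,
    and these lie in one member of the chain. *)
Lemma max_independent : exists G : set (M -> M'),
  [/\ G `<=` hom_on S N, independent G &
      forall phi, hom_on S N phi -> ~ G phi -> ~ independent (phi |` G)].
Proof.
pose P G := G `<=` hom_on S N /\ independent G.
have [F FP totF|G [[Ghom indG] maxG]] := @Zorn_bigcup _ P.
  split=> [phi [G FG Gphi]|s f us sF fS sum0 phi sphi].
    by have [Ghom _] := FP _ FG; exact: Ghom.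
  (* The list [s] contains [phi], which supplies a member [G0] of the chain for the base case of the
     induction. *)
  have [G FG sG] : exists2 G, F G & forall phi, phi \in s -> G phi.
    have [G0 FG0 _] := sF _ sphi.
    elim: (s) sF => [_|psi r IHr rF]; first by exists G0.
    have [|G FG rG] := IHr; first by move=> chi rchi; apply: rF; rewrite inE rchi orbT.
    have [G' FG' G'psi] := rF _ (mem_head _ _).
    have [GG'|G'G] := totF _ _ FG FG'.
      exists G' => // chi; rewrite inE => /predU1P[->//|/rG]; exact: GG'.
    by exists G => // chi; rewrite inE => /predU1P[->|/rG//]; exact: G'G.
  by have [_ indG] := FP _ FG; exact: (indG s f).
exists G; split=> // phi hphi nGphi indGphi; apply: (maxG (phi |` G)); last first.
  by split=> // psi [->//|/Ghom].
by split=> [|GphiG]; [exact: subsetUr | apply/nGphi/GphiG; left].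
Qed.

(** A map [phi] outside a maximal [G] satisfies a relation over [G] with [f phi] nonzero. Hence
    [phi] sends a nonzero element of [S] into the span, and by simplicity it sends all of [S]
    there. *)
Lemma trace_span (G : set (M -> M')) : G `<=` hom_on S N -> independent G ->
  (forall phi, hom_on S N phi -> ~ G phi -> ~ independent (phi |` G)) ->
  trace `<=` span G.
Proof.
move=> Ghom indG maxG.
have subspan : submodule (span G).
  apply: submodule_fsums => a _ [phi Gphi [x Sx <-]]; exists phi => //.
  have [_ _ hZ] := Ghom _ Gphi; have /submoduleP[_ _ SZ] := subS.
  by exists (a *: x); [exact: SZ | exact: hZ].
have /submoduleP[span0 spanD _] := subspan.
apply: fsums_ind => // _ [phi hphi [x Sx <-]].
have [Gphi|nGphi] := pselect (G phi).
  by apply: fsums1; exists phi => //; exists x.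
have [s [f [us sG Sf sum0 [psi spsi fpsi0]]]] :
    exists s (f : (M -> M') -> M), [/\ uniq s,
      forall psi, psi \in s -> (phi |` G) psi, forall psi, S (f psi),
      \sum_(psi <- s) psi (f psi) = 0 & exists2 psi, psi \in s & f psi <> 0].
  apply: contrapT => no; apply: (maxG _ hphi nGphi) => s f us sG Sf sum0 psi spsi.
  by apply: contrapT => fpsi0; apply: no; exists s, f; split=> //; exists psi.
have sphi : phi \in s.
  apply: contrapT => nsphi; apply: fpsi0; apply: (indG s f) => // chi schi.
  by have [echi|//] := sG _ schi; case: nsphi; rewrite -echi.
have remG chi : chi \in rem phi s -> G chi.
  rewrite mem_rem_uniq // inE => /andP[/eqP nchi schi].
  by have [] := sG _ schi.
have sumE : phi (f phi) = - \sum_(chi <- rem phi s) chi (f chi).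
  by apply/eqP; rewrite -addr_eq0; rewrite (big_rem phi) in sum0 => //; apply/eqP.
(* If the coefficient of [phi] vanished, the rest would be a nontrivial relation inside the
   independent [G]. *)
have fphi0 : f phi <> 0.
  move=> fphi0; apply: fpsi0; have [->//|npsi] := eqVneq psi phi.
  apply: (indG (rem phi s) f) => //; [exact: rem_uniq | | ].
    by apply/eqP; rewrite -oppr_eq0 -sumE fphi0 (hom_on0 subS hphi).
  by rewrite mem_rem_uniq // inE npsi.
have spanphi : span G (phi (f phi)).
  rewrite sumE; apply: submoduleN => //; rewrite big_seq_cond.
  apply: submodule_sum => // chi; rewrite andbT => /remG Gchi.
  by apply: fsums1; exists chi => //; exists (f chi).
have subK := hom_on_preim subS hphi subspan.
by have [] := simple_submodule_full simS subK (conj (Sf phi) spanphi) (Sf phi) fphi0 Sx.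
Qed.

Section Evaluation.
Variable G : set (M -> M').
Hypothesis Ghom : G `<=` hom_on S N.

(** The sum defaults to 0 when infinitely many terms are nonzero; it is only applied to members of
    [direct_power G S]. *)
Definition ev (f : G -> M) : M' := \sum_(g \in [set: G]) val g (f g).

Let homG (g : G) : hom_on S N (val g).
Proof. by apply/Ghom/set_mem; exact: valP. Qed.

Lemma evE (f : G -> M) (s : seq G) : uniq s -> (forall g, f g != 0 -> g \in s) ->
  ev f = \sum_(g <- s) val g (f g).
Proof.
move=> us sf; rewrite /ev (fsbigE s) //.
  by apply: eq_bigl => g; rewrite in_setT.
move=> g _ nsg; have -> : f g = 0.
  by apply/eqP; apply: contraNT nsg; exact: sf.
exact: hom_on0 subS (homG g).
Qed.

Lemma direct_power_seq (f : G -> M) : direct_power G S f ->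
  exists2 s : seq G, uniq s & forall g, f g != 0 -> g \in s.
Proof.
move=> [_ /finite_seqP[s sE]]; exists (undup s); first exact: undup_uniq.
by move=> g fg0; rewrite mem_undup; have : [set` s] g by rewrite -sE.
Qed.

Lemma direct_power_submodule : submodule (direct_power G S).
Proof.
have /submoduleP[S0 SD SZ] := subS.
apply/submoduleP; split=> [|f f' [Sf finf] [Sf' finf']|a f [Sf finf]].
- split=> [g|]; first exact: S0.
  by rewrite (_ : mkset _ = set0) // -subset0 => g /=; rewrite eqxx.
- split=> [g|]; first exact: SD.
  have : finite_set ([set g | f g != 0] `|` [set g | f' g != 0]).
    by rewrite finite_setU.
  apply: sub_finite_set => g /=; rewrite /GRing.add /=.
  have [->|?] := eqVneq (f g) 0; last by left.
  by have [->|?] := eqVneq (f' g) 0; [rewrite addr0 eqxx | right].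
- split=> [g|]; first exact: SZ.
  apply: sub_finite_set finf => g /=; apply: contra_neq => fg0.
  by rewrite scalrfctE fg0 scaler0.
Qed.

Lemma ev_hom : hom_on (direct_power G S) N ev.
Proof.
have /submoduleP[_ DPD DPZ] := direct_power_submodule.
split=> [f /[dup] -[Sf _] /direct_power_seq[s us sf]
        |f f' dpf dpf'|a f /[dup] -[Sf _] /direct_power_seq[s us sf]].
- rewrite (evE us sf); apply: submodule_sum => // g _.
  by have [hN _ _] := homG g; exact: hN.
- have [s us sf] := direct_power_seq dpf.
  have [s' us' sf'] := direct_power_seq dpf'.
  pose r := undup (s ++ s').
  have rE g : g \in r = (g \in s) || (g \in s') by rewrite mem_undup mem_cat.
  have ur : uniq r by exact: undup_uniq.
  rewrite !(@evE _ r) //.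
  + rewrite -big_split /=; apply: eq_bigr => g _.
    by have [_ hD _] := homG g; apply: hD; [case: dpf | case: dpf'].
  + by move=> g /sf'; rewrite rE orbC => ->.
  + by move=> g /sf; rewrite rE => ->.
  + move=> g; rewrite rE; have [fg0|/sf->//] := eqVneq (f g) 0.
    have [fg0'|/sf'->] := eqVneq (f' g) 0; last by rewrite orbT.
    by rewrite /GRing.add /= fg0 fg0' addr0 eqxx.
- rewrite !(@evE _ s) //.
  + rewrite scaler_sumr; apply: eq_bigr => g _.
    by have [_ _ hZ] := homG g; exact: hZ.
  + move=> g; have [fg0|/sf//] := eqVneq (f g) 0.
    by rewrite scalrfctE fg0 scaler0 eqxx.
Qed.

Lemma ev_inj : independent G -> set_inj (direct_power G S) ev.
Proof.
move=> indG; have inj0 f : direct_power G S f -> ev f = 0 -> f = 0.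
  move=> /[dup] -[Sf _] /direct_power_seq[s us sf]; rewrite (evE us sf) => sum0.
  apply/funext => g; apply/eqP; apply/negPn/negP => /[dup] fg0 /sf sg.
  (* [independent] speaks of coefficients indexed by all functions, so [f] is extended by 0 outside
     [G]. *)
  pose f' phi := if insub phi is Some h then f h else 0.
  have f'E h : f' (val h) = f h by rewrite /f' valK.
  have /submoduleP[S0 _ _] := subS.
  suff : f' (val g) = 0 by rewrite f'E; apply/eqP.
  apply: (indG (map val s) f').
  - by rewrite map_inj_uniq //; exact: val_inj.
  - by move=> _ /mapP[h _ ->]; apply/set_mem; exact: valP.
  - by move=> phi; rewrite /f'; case: insubP.
  - by rewrite big_map -[RHS]sum0; apply: eq_bigr => h _; rewrite f'E.
  - exact: map_f.
move=> f f' /set_mem dpf /set_mem dpf' eff'.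
have dpN := submoduleN direct_power_submodule dpf'.
have /submoduleP[_ DPD _] := direct_power_submodule.
have [_ evD _] := ev_hom.
apply/subr0_eq/inj0; first exact: DPD.
rewrite evD // eff' (hom_onN direct_power_submodule ev_hom) //; exact: subrr.
Qed.

Lemma ev_span : span G `<=` ev @` direct_power G S.
Proof.
have /submoduleP[im0 imD _] := hom_on_image direct_power_submodule ev_hom.
apply: fsums_ind => // _ [phi Gphi [x Sx <-]].
have /submoduleP[S0 _ _] := subS.
pose g : G := SigSub (mem_set Gphi).
pose f (h : G) : M := if h == g then x else 0.
have fg h : f h != 0 -> h \in [:: g].
  by rewrite /f inE; case: ifP => // _; rewrite eqxx.
exists f; last by rewrite (evE _ fg) // big_seq1 /f eqxx.
split=> [h|]; first by rewrite /f; case: ifP.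
apply: (@sub_finite_set _ _ [set` [:: g]]) => [h /= /fg//|].
by apply/finite_seqP; exists [:: g].
Qed.

End Evaluation.

Lemma trace_iso_direct_power :
  trace = N -> exists G : Type, submodule_iso N (direct_power G S).
Proof.
move=> trN; have [G [Ghom indG maxG]] := max_independent.
exists G; apply: submodule_iso_sym; first exact: direct_power_submodule.
apply: submodule_isoP; exists (@ev G); first exact: ev_hom.
split; first exact: ev_inj.
by rewrite -trN; apply: subset_trans (ev_span Ghom); exact: trace_span.
Qed.

(** Embed [S'] in a direct power of [S]: some coordinate of a nonzero element is nonzero, and that
    coordinate is a nonzero map between simple modules. *)
Lemma simple_trace_iso (S' : set M') : trace = N ->
  simple_submodule S' -> S' `<=` N -> submodule_iso S' S.
Proof.
move=> trN simS' S'N; have [G [f [[fN finj _] fD fZ]]] := trace_iso_direct_power trN.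
have [subS' S'n0 _] := simS'; have [x S'x x0] := nonzero_submodule subS' S'n0.
have hf : hom_on N (direct_power G S) f.
  split=> // [y z /mem_set Ny /mem_set Nz|a y /mem_set Ny];
  by [exact: fD | exact: fZ].
have [g fxg0] : exists g, f x g <> 0.
  apply: contrapT => no; apply: x0; have /submoduleP[N0 _ _] := subN.
  apply: finj; rewrite ?inE //; first exact: S'N.
  rewrite (hom_on0 subN hf); apply/funext => g; apply: contrapT => fxg0.
  by apply: no; exists g.
apply: (simple_hom_iso (phi := f^~ g) simS' simS _ S'x fxg0).
have [hN hD hZ] := hf.
split=> [y /S'N/hN[]//|y z /S'N Ny /S'N Nz|a y /S'N Ny].
- by rewrite hD.
- by rewrite hZ.
Qed.

Lemma trace_soc : trace `<=` soc N.
Proof.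
have /submoduleP[soc0 socD _] := soc_submodule N.
apply: fsums_ind => // _ [phi hphi [x Sx <-]]; exact: simple_hom_soc hphi x Sx.
Qed.

End Decomposition.

(** * Submodules as modules, and primitive annihilators *)

Section SubmoduleType.
Variables (A : pzRingType) (M : lmodType A) (S : set M) (subS : submodule S).

(** [left_primitive] asks for a module that is simple as a whole, so a simple submodule must become
    a type. The proof argument carries the closure properties to the module instance. *)
Definition submodule_type of submodule S : Type := {x : M | x \in S}.
Local Notation sub := (submodule_type subS).
HB.instance Definition _ := SubChoice.on sub.
HB.instance Definition _ :=
  GRing.SubChoice_isSubLmodule.Build A M [in S] sub (GRing.submod_closed_semi subS).

Definition submodule_val (x : sub) : M := val x.

Lemma submodule_val_hom : hom_on [set: sub] S submodule_val.
Proof.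
split=> [x _|x y _ _|a x _]; first exact: set_mem (valP x).
- exact: raddfD.
- exact: linearZ.
Qed.

Lemma submodule_val_inj : injective submodule_val.
Proof. exact: val_inj. Qed.

Lemma submodule_val_surj : S `<=` range submodule_val.
Proof. by move=> x Sx; exists (Sub x (mem_set Sx)) => //; exact: SubK. Qed.

Lemma submoduleT : submodule [set: sub].
Proof. exact/submoduleP. Qed.

Lemma simple_submodule_type : simple_submodule S -> simple_submodule [set: sub].
Proof.
move=> [_ Sn0 minS]; have hval := submodule_val_hom.
split=> [||K subK _]; first exact: submoduleT.
  move=> sub0; apply: Sn0; apply/seteqP; split=> [x /submodule_val_surj[y _ <-]|_ ->].
    have : [set: sub] y by []; rewrite sub0 => ->.
    by rewrite /= (hom_on0 submoduleT hval).
  by have /submoduleP[] := subS.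
have hK : hom_on K S submodule_val.
  by have [hS hD hZ] := hval; split=> *; [exact: hS | exact: hD | exact: hZ].
have [|K0|KS] := minS _ (hom_on_image subK hK).
- by move=> _ [x Kx <-]; have [hS _ _] := hK; exact: hS.
- left; apply/seteqP; split=> [x Kx|_ ->]; last by have /submoduleP[] := subK.
  apply: submodule_val_inj; rewrite (hom_on0 submoduleT hval).
  by have : (submodule_val @` K) (submodule_val x) by []; rewrite K0.
- right; apply/seteqP; split=> // x _.
  have [hS _ _] := hval; have := hS x I; rewrite -KS => -[y Ky].
  by move=> /submodule_val_inj <-.
Qed.

End SubmoduleType.

Lemma annihilator_primitive (A : pzRingType) (M : lmodType A) (S : set M) :
  simple_submodule S -> left_primitive [set a | forall x, S x -> a *: x = 0].
Proof.
move=> simS; have [subS _ _] := simS.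
exists (submodule_type subS : lmodType A); first exact: simple_submodule_type.
have [hS hD hZ] := submodule_val_hom subS.
have val0 := hom_on0 (submoduleT subS) (submodule_val_hom subS).
apply/seteqP; split=> a /= aS x.
  by apply: submodule_val_inj; rewrite hZ // val0; apply: aS; exact: hS.
move=> /(submodule_val_surj subS)[y _ <-].
by rewrite -hZ // aS val0.
Qed.

(** * The Jacobson radical *)

Section Jacobson.
Variable A : pzRingType.
Implicit Types L : set A.

Lemma left_idealP L : left_ideal L <->
  [/\ L 0, (forall x y, L x -> L y -> L (x + y)) & (forall a x, L x -> L (a * x))].
Proof. exact: (@submoduleP A A^o L). Qed.

Lemma left_ideal_full L : left_ideal L -> L 1 -> L = setT.
Proof.
move=> /left_idealP[_ _ LM] L1; apply/seteqP; split=> // a _.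
by rewrite -[a]mulr1; exact: LM.
Qed.

Lemma exists_maximal_left_ideal L : left_ideal L -> ~ L 1 ->
  exists2 L', maximal_left_ideal L' & L `<=` L'.
Proof.
move=> idL L1.
(* Vacuous on [set0], so that the empty chain satisfies it. *)
pose P X := X !=set0 -> [/\ left_ideal X, L `<=` X & ~ X 1].
have [F FP totF|K [PK maxK]] := @Zorn_bigcup _ P.
  move=> [x [X0 FX0 X0x]].
  have FX X y : F X -> X y -> [/\ left_ideal X, L `<=` X & ~ X 1].
    by move=> FX Xy; apply: (FP _ FX); exists y.
  have [/left_idealP[X00 _ _] LX0 _] := FX _ _ FX0 X0x.
  split; last first.
  - by move=> [X FX' X1]; have [_ _] := FX _ _ FX' X1; exact.
  - by move=> y Ly; exists X0 => //; exact: LX0.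
  apply/left_idealP; split=> [|y z [X FX' Xy] [Y FY Yz]|a y [X FX' Xy]].
  - by exists X0.
  - have [/left_idealP[_ XD _] _ _] := FX _ _ FX' Xy.
    have [/left_idealP[_ YD _] _ _] := FX _ _ FY Yz.
    have [XY|YX] := totF _ _ FX' FY.
      by exists Y => //; apply: YD => //; exact: XY.
    by exists X => //; apply: XD => //; exact: YX.
  - have [/left_idealP[_ _ XM] _ _] := FX _ _ FX' Xy.
    by exists X => //; exact: XM.
have PL : P L by move=> _; split.
have /left_idealP[L0 _ _] := idL.
(* Since the empty set satisfies [P], it has to be ruled out as the maximal element: [L] is strictly
   larger. *)
have K0 : K !=set0.
  apply/set0P/negP => /eqP K0; apply: (maxK L) => //.
  by rewrite K0; split=> // /(_ _ L0).
have [idK LK K1] := PK K0.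
exists K => //; split=> // [KT|J idJ KJ]; first by apply: K1; rewrite KT.
have [J1|J1] := pselect (J 1); [by right; exact: left_ideal_full | left].
apply: contrapT => JK; apply: (maxK J).
  by split=> // JK'; apply: JK; apply/seteqP.
by split=> //; exact: subset_trans KJ.
Qed.

(** If [1 - a * x] has no left inverse, a maximal left ideal contains it together with [a * x],
    hence 1. Conversely, if [x] avoids a maximal [L], then [1 = l + a * x] with [l] in [L], and [l]
    is left invertible. *)
Lemma jacobsonP x : jacobson A x <-> forall a, exists u, u * (1 - a * x) = 1.
Proof.
split=> [Jx a|inv L [idL LT maxL]].
  have idL : left_ideal (range ( *%R^~ (1 - a * x))).
    apply/left_idealP; split=> [|_ _ [u _ <-] [v _ <-]|b _ [u _ <-]].
    - by exists 0 => //; rewrite mul0r.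
    - by exists (u + v) => //; rewrite mulrDl.
    - by exists (b * u) => //; rewrite /= mulrA.
  have [[u _ u1]|L1] := pselect (range ( *%R^~ (1 - a * x)) 1); first by exists u.
  have [L maxL sL] := exists_maximal_left_ideal idL L1.
  have [idL' LT _] := maxL; have /left_idealP[_ LD LM] := idL'.
  case: LT; apply: left_ideal_full => //; rewrite -(subrK (a * x) 1).
  by apply: LD; [apply: sL; exists 1; rewrite ?mul1r | apply: LM; exact: Jx].
have /left_idealP[L0 LD LM] := idL; apply: contrapT => nLx.
pose J := [set y | exists2 l, L l & exists a, y = l + a * x].
have idJ : left_ideal J.
  apply/left_idealP; split=> [|_ _ [l Ll [a ->]] [m Lm [b ->]]|b _ [l Ll [a ->]]].
  - by exists 0 => //; exists 0; rewrite mul0r addr0.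
  - by exists (l + m); [exact: LD | exists (a + b); rewrite mulrDl addrACA].
  - by exists (b * l); [exact: LM | exists (b * a); rewrite mulrDr mulrA].
have [|JL|JT] := maxL _ idJ.
- by move=> l Ll; exists l => //; exists 0; rewrite mul0r addr0.
- by apply: nLx; rewrite -JL; exists 0 => //; exists 1; rewrite mul1r add0r.
- have [l Ll [a e1]] : J 1 by rewrite JT.
  have [u u1] := inv a; apply: LT; apply: left_ideal_full => //.
  by rewrite -u1 e1 addrK; exact: LM.
Qed.

(** The one-sided form of Jacobson's identity, suggested by expanding the inverse of [1 - b * a] as
    a geometric series. *)
Lemma left_inv_swap (a b u : A) : u * (1 - a * b) = 1 ->
  (1 + b * u * a) * (1 - b * a) = 1.
Proof.
move=> u1; have swap : a * (1 - b * a) = (1 - a * b) * a.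
  by rewrite mulrBr mulrBl mulr1 mul1r mulrA.
rewrite mulrDl mul1r -[b * u * a * _]mulrA swap -[b * u * _]mulrA [u * _]mulrA u1.
by rewrite mul1r subrK.
Qed.

Lemma jacobsonMr x a : jacobson A x -> jacobson A (x * a).
Proof.
move=> /jacobsonP Jx; apply/jacobsonP => b.
have [u] := Jx (a * b); rewrite -mulrA => /left_inv_swap u1.
by exists (1 + b * x * u * a); rewrite [b * (x * a)]mulrA.
Qed.

(** If [a *: x] were nonzero it would generate [S], so [b *: (a *: x) = x] for some [b]; then the
    left invertible [1 - b * a] kills [x], hence [x = 0]. *)
Lemma jacobson_annihilates (M : lmodType A) (S : set M) a x :
  simple_submodule S -> jacobson A a -> S x -> a *: x = 0.
Proof.
move=> simS /jacobsonP Ja Sx; have [subS _ _] := simS.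
have /submoduleP[S0 SD SZ] := subS; apply: contrapT => ax0.
have subK : submodule (range (fun b => b *: (a *: x))).
  apply/submoduleP; split=> [|_ _ [b _ <-] [c _ <-]|b _ [c _ <-]].
  - by exists 0 => //; rewrite scale0r.
  - by exists (b + c) => //; rewrite scalerDl.
  - by exists (b * c) => //; rewrite -scalerA.
have [||b _ bx] := simple_submodule_full simS subK _ _ ax0 Sx.
- by exists 1 => //; rewrite scale1r.
- exact: SZ.
have [u u1] := Ja b; apply: ax0; rewrite -[x]scale1r -u1 -scalerA scalerBl.
by rewrite scale1r -scalerA bx subrr !scaler0.
Qed.

End Jacobson.

Lemma ideal_mul_eq0 (A : pzRingType) (I J : set A) x y :
  ideal_mul I J = [set 0] -> I x -> J y -> x * y = 0.
Proof.
move=> IJ0 Ix Jy; have : ideal_mul I J (x * y).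
  by exists 1%N, (fun=> x), (fun=> y); rewrite big_ord1.
by rewrite IJ0.
Qed.

(** * Ideals meeting a maximal subring trivially *)

Section ComplementedIdeal.
Variables (T : pzRingType) (R : subringClosed T) (I : set T).
Hypotheses (maxR : maximal_subring R) (idI : ideal I).
Hypothesis RI0 : [set` R] `&` I = [set 0].

Local Notation M := (res_scalars R).
Implicit Types K S : set M.

Let I0 : I 0. Proof. by have /idealP[] := idI. Qed.
Let ID x y : I x -> I y -> I (x + y).
Proof. by have /idealP[_ D _ _] := idI; exact: D. Qed.
Let IMl a x : I x -> I (a * x).
Proof. by have /idealP[_ _ Ml _] := idI; exact: Ml. Qed.
Let IMr a x : I x -> I (x * a).
Proof. by have /idealP[_ _ _ Mr] := idI; exact: Mr. Qed.
Let IN x : I x -> I (- x).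
Proof. by move=> Ix; rewrite -mulN1r; exact: IMl. Qed.
Let IB x y : I x -> I y -> I (x - y).
Proof. by move=> Ix Iy; apply: ID => //; exact: IN. Qed.

Let RI_eq0 x : x \in R -> I x -> x = 0.
Proof. by move=> Rx Ix; have : ([set` R] `&` I) x by []; rewrite RI0. Qed.

Lemma res_submoduleP K : submodule K <->
  [/\ K 0, (forall x y : T, K x -> K y -> K (x + y)) &
      (forall a x : T, a \in R -> K x -> K (a * x))].
Proof.
split=> [/submoduleP[K0 KD KZ]|[K0 KD KM]]; last first.
  by apply/submoduleP; split=> // a x; apply: KM; exact: valP.
by split=> // a x Ra Kx; have := KZ (Sub a Ra : subring_type R) x Kx.
Qed.

(** The sum of [R] and [K] is a subring, strictly larger than [R] because [K] meets [R] in 0;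
    maximality makes it [T]. Closure is asked only under [R] and under products inside [K], so that
    [RaR] can qualify as well as [I]. *)
Lemma subbimodule_complement K : submodule K -> K `<=` I ->
  (forall a x : T, a \in R -> K x -> K (x * a)) ->
  (forall x y : T, K x -> K y -> K (x * y)) ->
  K <> [set 0] -> forall x : T, exists2 r, r \in R & K (x - r).
Proof.
move=> subK KI KMr KM Kn0; have /res_submoduleP[K0 KD KMl] := subK.
have KB (x y : T) : K x -> K y -> K (x - y).
  by move=> Kx Ky; apply: KD => //; exact: (submoduleN subK Ky).
pose P : {pred T} := fun x => `[< exists2 r, r \in R & K (x - r) >].
have PP x : reflect (exists2 r, r \in R & K (x - r)) (x \in P) by exact: asboolP.
have Pring : subring_closed P.
  split=> [|x y /PP[r Rr Kr] /PP[s Rs Ks]|x y /PP[r Rr Kr] /PP[s Rs Ks]].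
  - by apply/PP; exists 1; [exact: rpred1 | rewrite subrr].
  - apply/PP; exists (r - s); first exact: rpredB.
    by rewrite opprD addrACA -opprD; exact: KB.
  - apply/PP; exists (r * s); first exact: rpredM.
    have -> : x * y - r * s = (x - r) * (y - s) + (x - r) * s + r * (y - s).
      by rewrite -mulrDr subrK mulrBl mulrBr addrA subrK.
    by apply: (KD); [apply: KD; [exact: KM | exact: KMr] | exact: KMl].
have RP : {subset R <= P} by move=> r Rr; apply/PP; exists r; rewrite ?subrr.
have [x Kx x0] := nonzero_submodule subK Kn0.
have [_ /(_ P Pring RP)[PR|PT]] := maxR.
  case: x0; apply: RI_eq0 (KI _ Kx); rewrite -PR.
  by apply/PP; exists 0; [exact: rpred0 | rewrite subr0].
by move=> y; apply/PP; rewrite PT.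
Qed.

Lemma subbimodule_eq_ideal K : submodule K -> K `<=` I ->
  (forall a x : T, a \in R -> K x -> K (x * a)) ->
  (forall x y : T, K x -> K y -> K (x * y)) ->
  K <> [set 0] -> K = I.
Proof.
move=> subK KI KMr KM Kn0; apply/seteqP; split=> // x Ix.
have [r Rr Kr] := subbimodule_complement subK KI KMr KM Kn0 x.
suff r0 : r = 0 by rewrite r0 subr0 in Kr.
(* [r] is the difference of [x] and [x - r], both in [I]. *)
by apply: RI_eq0 => //; rewrite -(subKr x r); apply: IB => //; exact: KI.
Qed.

Lemma ideal_submodule : submodule (I : set M).
Proof. by apply/res_submoduleP; split=> // a x _; exact: IMl. Qed.

(** Right multiplications commute with the left action of [R]; this is the source of the right
    stability of traces and socles under [T]. *)
Lemma right_mul_hom K K' (t : T) : (forall x, K x -> K' ((x : T) * t)) ->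
  hom_on K K' (fun x : M => (x : T) * t : M).
Proof.
move=> KK'; split=> // [x y _ _|a x _]; first exact: mulrDl.
by rewrite /GRing.scale /= mulrA.
Qed.

Lemma trace_ideal S : simple_submodule S -> S `<=` I -> trace S (I : set M) = I.
Proof.
move=> simS SI; have [subS Sn0 _] := simS.
have subtr : submodule (trace S (I : set M)).
  have /submoduleP[_ _ SZ] := subS.
  apply: submodule_fsums => a _ [phi hphi [x Sx <-]]; exists phi => //.
  by have [_ _ hZ] := hphi; exists (a *: x); [exact: SZ | exact: hZ].
have trMr (t x : T) : trace S (I : set M) x -> trace S (I : set M) (x * t).
  move: x; apply: (@fsums_ind M _ [set x | trace S (I : set M) ((x : T) * t)]) => /=.
  - by rewrite mul0r; exact: fsums0.
  - by move=> x y trx tr_y; rewrite mulrDl; exact: fsumsD.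
  - move=> _ [phi hphi [x Sx <-]]; apply: fsums1.
    exists ((fun y : M => (y : T) * t : M) \o phi); last by exists x.
    by apply: (hom_on_comp hphi); apply: right_mul_hom => y; exact: IMr.
apply: subbimodule_eq_ideal => //.
- by apply: subset_trans (trace_soc simS) _; exact: soc_sub ideal_submodule.
- by move=> a x _; exact: trMr.
- by move=> x y trx _; exact: trMr.
- have [x Sx x0] := nonzero_submodule subS Sn0.
  move=> tr0; apply: x0; suff : trace S (I : set M) x by rewrite tr0.
  (* The inclusion of [S] in [I] is one of the maps defining the trace. *)
  by apply: fsums1; exists id; [split | exists x].
Qed.

Hypothesis In0 : I <> [set 0].

(** Existence of the decomposition comes from [subbimodule_complement] with [K] equal to [I],
    uniqueness from the trivial intersection. Since [I] is an ideal, [p] is multiplicative. *)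
Lemma exists_projection : exists p : T -> T,
  [/\ forall x, p x \in R, forall x, I (x - p x),
     forall x r, r \in R -> I (x - r) -> p x = r,
     {morph p : x y / x + y} & {morph p : x y / x * y}].
Proof.
have /choice[p pP] : forall x, exists r, r \in R /\ I (x - r).
  move=> x; have [||r Rr Ir] :=
      subbimodule_complement ideal_submodule (@subset_refl _ I) _ _ In0 x.
  - by move=> *; exact: IMr.
  - by move=> *; exact: IMr.
  - by exists r.
have pR x : p x \in R by case: (pP x).
have pI x : I (x - p x) by case: (pP x).
have pE x r : r \in R -> I (x - r) -> p x = r.
  move=> Rr Ir; apply/subr0_eq/RI_eq0; first exact: rpredB.
  by rewrite -(subrK x (p x)) -addrA -opprB addrC; exact: IB.
exists p; split=> // x y; apply: pE.
- exact: rpredD.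
- by rewrite opprD addrACA; exact: ID.
- exact: rpredM.
- have -> : x * y - p x * p y = (x - p x) * y + p x * (y - p y).
    by rewrite mulrBl mulrBr addrA subrK.
  by apply: ID; [exact: IMr | exact: IMl].
Qed.

(** * The socle of [T] over [R] *)

Lemma subring_submodule : submodule ([set` R] : set M).
Proof.
apply/res_submoduleP; split=> [|x y|a x] /=; first exact: rpred0.
- exact: rpredD.
- exact: rpredM.
Qed.

Lemma soc_res_mulr (x t : T) : soc [set: M] x -> soc [set: M] (x * t : T).
Proof.
have /submoduleP[soc0 socD _] := soc_submodule [set: M].
move: x; apply: (@soc_ind _ M _ [set x | soc [set: M] ((x : T) * t)]) => /=.
- by rewrite mul0r.
- by move=> x y sx sy; rewrite mulrDl; exact: socD.
- move=> S simS _ x Sx.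
  by apply: (simple_hom_soc simS (@right_mul_hom S [set: M] t _) Sx).
Qed.

(** The projection of [S] to [I] is linear, and a nonzero image would be a simple submodule of [I];
    hence [p] fixes [S]. *)
Lemma simple_subring S : (forall S', simple_submodule S' -> ~ S' `<=` I) ->
  simple_submodule S -> S `<=` [set` R].
Proof.
move=> noS simS x Sx; have [p [pR pI pE pD pM]] := exists_projection.
have hom : hom_on S (I : set M) (fun y : M => (y : T) - p y : M).
  split=> [y _|y z _ _|a y _]; first exact: pI.
  - by rewrite pD opprD addrACA.
  - rewrite /GRing.scale /= pM mulrBr; congr (_ - _ * _); apply: pE.
      exact: valP.
    by rewrite subrr.
have [e|x0] := pselect ((x : T) - p x = 0); first by rewrite /= (subr0_eq e).
case: (noS _ (simple_hom_image simS hom Sx x0)) => _ [y Sy <-]; exact: pI.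
Qed.

Lemma soc_without_simple : (forall S, simple_submodule S -> ~ S `<=` I) ->
  soc ([set` R] : set M) = soc [set: M] /\ soc [set: M] `<=` rconductor R.
Proof.
move=> noS; suff socE : soc ([set` R] : set M) = soc [set: M].
  split=> // x sx t; have := soc_res_mulr t sx; rewrite -socE.
  exact: soc_sub subring_submodule _.
apply/seteqP; split; first exact: socS.
have /submoduleP[soc0 socD _] := soc_submodule ([set` R] : set M).
apply: soc_ind => // S simS _; apply: simple_soc => //; exact: simple_subring.
Qed.

(** Both projections of [T] are linear over [R], so they carry each simple submodule into the socle
    of the corresponding summand. *)
Lemma soc_direct_sum : direct_sum_of (soc [set: M])
  (soc ([set` R] : set M)) (soc (I : set M)).
Proof.
have /submoduleP[socT0 socTD _] := soc_submodule [set: M].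
have /submoduleP[socR0 socRD _] := soc_submodule ([set` R] : set M).
have /submoduleP[socI0 socID _] := soc_submodule (I : set M).
have [p [pR pI pE pD pM]] := exists_projection.
have pid r : r \in R -> p r = r by move=> Rr; apply: pE => //; rewrite subrr.
split; apply/seteqP; split.
- apply: soc_ind => [|_ _ [x sx [y sy <-]] [z sz [w sw <-]]|S simS _ x Sx].
  + by exists 0 => //; exists 0 => //; rewrite addr0.
  + exists (x + z); first exact: socRD.
    by exists (y + w); [exact: socID | rewrite addrACA].
  + have homR : hom_on S ([set` R] : set M) (fun y : M => p y : M).
      split=> [y _|y z _ _|a y _]; [exact: pR | exact: pD |].
      by rewrite /GRing.scale /= pM pid //; exact: valP.
    have homI : hom_on S (I : set M) (fun y : M => (y : T) - p y : M).
      split=> [y _|y z _ _|a y _]; [exact: pI | by rewrite pD opprD addrACA |].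
      by rewrite /GRing.scale /= pM mulrBr pid //; exact: valP.
    exists (p x); first exact: simple_hom_soc homR _ Sx.
    exists ((x : T) - p x); first exact: simple_hom_soc homI _ Sx.
    by rewrite addrC subrK.
- by move=> _ [x sx [y sy <-]]; apply: socTD; [move: sx | move: sy]; exact: socS.
- move=> x [/(soc_sub subring_submodule) Rx /(soc_sub ideal_submodule) Ix].
  exact: RI_eq0.
- by move=> _ ->.
Qed.

(** * The conductor, the two radicals and ideals of square zero *)

Lemma rconductorE : rconductor R = [set x | x \in R /\ forall y, I y -> x * y = 0].
Proof.
have [p [pR pI pE pD pM]] := exists_projection.
apply/seteqP; split=> x /=.
  move=> xT; have Rx : x \in R by rewrite -[x]mulr1.
  by split=> // y Iy; apply: RI_eq0 => //; exact: IMl.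
(* As [x] kills the part of [t] in [I], the product [x * t] equals [x * p t]. *)
by move=> [Rx xI] t; rewrite -[t](subrK (p t)) mulrDr xI // add0r rpredM.
Qed.

(** [I] is a sum of linear images of [S], so an element killing [S] kills [I]. *)
Lemma rconductor_annihilator S : trace S (I : set M) = I -> submodule S ->
  S `<=` I ->
  val @^-1` rconductor R = [set a : subring_type R | forall x : M, S x -> a *: x = 0].
Proof.
move=> trI subS SI; rewrite rconductorE; apply/seteqP; split=> a /=.
  by move=> [_ aI] x /SI; exact: aI.
move=> aS; split=> [|y]; first exact: valP.
rewrite -trI; move: y; apply: (@fsums_ind M _ [set y | val a * (y : T) = 0]) => /=.
- exact: mulr0.
- by move=> x y; rewrite mulrDr => -> ->; rewrite addr0.
- move=> _ [phi hphi [x Sx <-]]; have [_ _ hZ] := hphi.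
  by have := hZ a x Sx; rewrite (aS _ Sx) (hom_on0 subS hphi).
Qed.

Lemma jacobson_subring : val @` jacobson (subring_type R) `<=` rconductor R ->
  val @` jacobson (subring_type R) = jacobson T `&` [set` R].
Proof.
move=> JR; have [p [pR pI pE pD pM]] := exists_projection.
have pid r : r \in R -> p r = r by move=> Rr; apply: pE => //; rewrite subrr.
apply/seteqP; split=> [_ [x Jx <-]|x [Jx Rx]].
  split; last exact: valP; apply/jacobsonP => t.
  have Rxt : val x * t \in R by apply: JR; exists x.
  (* Here [x * t = x * p t] lies in the Jacobson radical of [R], a right ideal, so the left inverse
     is found in [R]. It is then moved from [1 - x * t] to [1 - t * x]. *)
  have [u u1] : exists u : T, u * (1 - 1 * (val x * t)) = 1.
    have -> : val x * t = val (x * Sub (p t) (pR t) : subring_type R).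
      rewrite rmorphM /= -{1}[t](subrK (p t)) mulrDr.
      have : rconductor R (val x) by apply: JR; exists x.
      by rewrite rconductorE => -[_ ->//]; rewrite add0r.
    have /jacobsonP/(_ 1)[u u1] := jacobsonMr (Sub (p t) (pR t)) Jx.
    exists (val u); have := congr1 val u1.
    by rewrite rmorphM rmorphB rmorph1 rmorphM rmorph1.
  by exists (1 + t * u * val x); apply: left_inv_swap; rewrite mul1r in u1.
(* For the converse, [p] is multiplicative and fixes [R], so it turns a left inverse in [T] into one
   in [R]. *)
exists (Sub x Rx) => //; apply/jacobsonP => a.
have /jacobsonP/(_ (val a))[u u1] := Jx.
exists (Sub (p u) (pR u)); apply: val_inj.
rewrite rmorphM rmorphB !rmorph1 rmorphM /=.
have R1 : 1 - val a * x \in R by rewrite rpredB ?rpred1 ?rpredM //; exact: valP.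
by rewrite -[1 - _]pid // -pM u1 pid // rpred1.
Qed.

Lemma upper_nilradical_subring :
  val @` upper_nilradical (subring_type R) `<=` rconductor R ->
  val @` upper_nilradical (subring_type R) = upper_nilradical T `&` [set` R].
Proof.
move=> NR; have [p [pR pI pE pD pM]] := exists_projection.
have pid r : r \in R -> p r = r by move=> Rr; apply: pE => //; rewrite subrr.
pose q t : subring_type R := Sub (p t) (pR t).
have qD s t : q (s + t) = q s + q t by apply: val_inj; rewrite rmorphD /= pD.
have qM s t : q (s * t) = q s * q t by apply: val_inj; rewrite rmorphM /= pM.
have qid x : q (val x) = x by apply: val_inj; rewrite /= pid //; exact: valP.
have q0 : q 0 = 0 by rewrite -[RHS]qid rmorph0.
have q1 : q 1 = 1 by rewrite -[RHS]qid rmorph1.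
have qX t n : q (t ^+ n) = q t ^+ n by elim: n => // n IHn; rewrite !exprS qM IHn.
have /idealP[N0 ND NMl NMr] := @upper_nilradical_ideal (subring_type R).
apply/seteqP; split=> [_ [x Nx <-]|x [[L [idL nilL] Lx] Rx]].
  split; last exact: valP.
  (* A nil ideal of [T] containing [x]: the condition on products with [I] is stable on both sides
     because [I] is an ideal. *)
  pose K := [set t | upper_nilradical (subring_type R) (q t) /\
                     forall i, I i -> t * i = 0].
  exists K; last first.
    have : rconductor R (val x) by apply: NR; exists x.
    by rewrite rconductorE => -[_ xI]; split=> //; rewrite qid.
  split; first (apply/idealP; split).
  - by split=> [|i _]; [rewrite q0 | rewrite mul0r].
  - move=> s t [Ns sI] [Nt tI]; split; first by rewrite qD; exact: ND.
    by move=> i Ii; rewrite mulrDl sI // tI // addr0.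
  - move=> a t [Nt tI]; split; first by rewrite qM; exact: NMl.
    by move=> i Ii; rewrite -mulrA tI // mulr0.
  - move=> t a [Nt tI]; split; first by rewrite qM; exact: NMr.
    by move=> i Ii; rewrite -mulrA tI //; exact: IMl.
  (* From [q t ^+ n = 0] one only gets [t ^+ n] in [I]; one more factor [t] kills it. *)
  move=> t [/upper_nilradical_nil[n qtn] tI]; exists n.+1.
  rewrite exprS tI // -[_ ^+ n]subr0.
  by have := pI (t ^+ n); rewrite -[p _]/(val (q (t ^+ n))) qX qtn rmorph0.
exists (Sub x Rx) => //; exists [set y | L (val y)] => //; split.
  have /idealP[L0 LD LMl LMr] := idL; apply/idealP; split=> /=.
  - exact: L0.
  - by move=> y z Ly Lz; exact: LD.
  - by move=> a y Ly; exact: LMl.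
  - by move=> y a Ly; exact: LMr.
move=> y /nilL[n yn]; exists n; apply: val_inj; by rewrite rmorphXn rmorph0.
Qed.

Lemma square_zero_bimodule_span (a : T) : ideal_mul I I = [set 0] -> I a -> a <> 0 ->
  I = bimodule_span R a.
Proof.
move=> II0 Ia a0.
pose B : set M := [set x : T | exists r s : subring_type R, x = val r * a * val s].
have spanE : bimodule_span R a = fsums B.
  apply/seteqP; split=> [x [n [r [s ->]]]|x [n [u [/choice[r /choice[s rsE]] ->]]]].
    exists n, (fun i => val (r i) * a * val (s i)); split=> // i.
    by exists (r i), (s i).
  by exists n, r, s; apply: eq_bigr => i _; exact: rsE.
have BI : fsums B `<=` I.
  apply: fsums_ind => // _ [r [s ->]]; exact/IMr/IMl.
rewrite spanE; apply/esym/subbimodule_eq_ideal => //.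
- apply: submodule_fsums => b _ [r [s ->]]; exists (b * r), s.
  by rewrite /GRing.scale /= !mulrA.
- move=> b x Rb; move: x.
  apply: (@fsums_ind M _ [set x | fsums B ((x : T) * b)]) => /=.
  + by rewrite mul0r; exact: fsums0.
  + by move=> x y Bx By; rewrite mulrDl; exact: fsumsD.
  + move=> _ [r [s ->]]; apply: fsums1.
    by exists r, (s * Sub b Rb); rewrite rmorphM /= mulrA.
(* Closure under products is where [I] having square zero enters. *)
- move=> x y /BI Ix /BI Iy; rewrite (ideal_mul_eq0 II0 Ix Iy); exact: fsums0.
- move=> B0; apply: a0; suff : fsums B a by rewrite B0.
  by apply: fsums1; exists 1, 1; rewrite rmorph1 mul1r mulr1.
Qed.

End ComplementedIdeal.

Lemma upper_nilradical_jacobson (A : pzRingType) :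
  upper_nilradical A `<=` jacobson A.
Proof.
have /idealP[_ _ NMl _] := @upper_nilradical_ideal A.
move=> x Nx; apply/jacobsonP => a.
have [n axn] := upper_nilradical_nil (NMl a x Nx).
exists (\sum_(i < n) (a * x) ^+ i).
have inv : (1 - a * x) * \sum_(i < n) (a * x) ^+ i = 1.
  by rewrite -opprB mulNr -subrX1 axn sub0r opprK.
(* The geometric sum is a right inverse of [1 - a * x]; it commutes with it, hence is also a left
   inverse. *)
rewrite -[RHS]inv; apply/esym/commr_sum => i _; apply/commrX/commr_sym/commrB.
  exact: commr1.
exact: commr_refl.
Qed.

Theorem proposition3p13 (T : pzRingType) (R : subringClosed T) (I : set T)
    (maxR : maximal_subring R) (idI : ideal I) (I_neq0 : I <> [set 0])
    (RI0 : [set` R] `&` I = [set 0]) :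
  (soc ([set` R] : set (res_scalars R)) = soc [set: res_scalars R] /\
   soc [set: res_scalars R] `<=` rconductor R)
  \/
  [/\ direct_sum_of (soc [set: res_scalars R])
        (soc ([set` R] : set (res_scalars R))) (soc (I : set (res_scalars R))),
      soc (I : set (res_scalars R)) = I,
      (forall S S' : set (res_scalars R),
         simple_submodule S -> S `<=` I -> simple_submodule S' -> S' `<=` I ->
         submodule_iso S S') /\
      (exists (S : set (res_scalars R)) (Gamma : Type),
         [/\ simple_submodule S, S `<=` I &
             submodule_iso (I : set (res_scalars R)) (direct_power Gamma S)]) &
  [/\ left_primitive (val @^-1` rconductor R : set (subring_type R)) /\
      val @` jacobson (subring_type R) `<=` rconductor R,
      val @` jacobson (subring_type R) = jacobson T `&` [set` R] /\
      val @` upper_nilradical (subring_type R) =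
        upper_nilradical T `&` [set` R] &
      ideal_mul I I = [set 0] -> forall a : T, I a -> a <> 0 ->
        I = bimodule_span R a]].
Proof.
(* The alternative is decided by whether [I] contains a simple submodule over [R]. *)
have [[S [simS SI]]|noS] := pselect (exists S : set (res_scalars R),
    simple_submodule S /\ S `<=` I); last first.
  left; apply: (soc_without_simple maxR idI RI0 I_neq0) => S simS SI.
  by apply: noS; exists S.
right; have subI := @ideal_submodule T R I idI.
have [subS _ _] := simS.
have trI := @trace_ideal T R I maxR idI RI0.
have condE := rconductor_annihilator maxR idI RI0 I_neq0 (trI _ simS SI) subS SI.
have JR : val @` jacobson (subring_type R) `<=` rconductor R.
  move=> _ [x Jx <-]; suff : (val @^-1` rconductor R) x by [].
  by rewrite condE => y Sy; exact: jacobson_annihilates simS Jx Sy.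
split.
- exact: (soc_direct_sum maxR idI RI0 I_neq0).
- apply/seteqP; split; first exact: soc_sub.
  by rewrite -{1}(trI _ simS SI); exact: trace_soc.
- split=> [S1 S2 simS1 S1I simS2 S2I|].
    exact: (simple_trace_iso simS2 subI (trI _ simS2 S2I) simS1 S1I).
  have [G isoG] := trace_iso_direct_power simS subI (trI _ simS SI).
  by exists S, G.
- split; [split=> // | split | move=> II0 a].
  + by rewrite condE; exact: annihilator_primitive.
  + exact: (jacobson_subring maxR idI RI0 I_neq0 JR).
  (* The nilradical of [R] lies in its Jacobson radical, hence in the conductor. *)
  + apply: (upper_nilradical_subring maxR idI RI0 I_neq0); apply: subset_trans JR.
    by apply: image_subset; exact: upper_nilradical_jacobson.
  + exact: (square_zero_bimodule_span maxR idI RI0 II0).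
Qed.
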